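(* Let $(\mathfrak{g},[\cdot,\cdot,\cdot]_{\mathfrak{g}},\{\cdot,\cdot,\cdot\}_{\mathfrak{g}})$ be a compatible $3$-Lie algebra and $(V;\rho,\mu)$ a representation of it. Two abelian extensions of compatible $3$-Lie algebras $\mathfrak{g}\oplus_{\rho,\mu,\omega_1,\omega_2}V$ and $\mathfrak{g}\oplus_{\rho,\mu,\omega_1',\omega_2'}V$ of $\mathfrak{g}$ by $V$ are isomorphic if and only if the $2$-cocycles $(\omega_1,\omega_2)$ and $(\omega_1',\omega_2')$ are in the same cohomology class.
   Context: All vector spaces are finite-dimensional over an algebraically closed field $\mathbb{K}$ of characteristic $0$. A 3-Lie algebra is a vector space $\mathfrak{g}$ with a skew-symmetric trilinear map $[\cdot,\cdot,\cdot]:\wedge^3\mathfrak{g}\to\mathfrak{g}$ such that $[x_1,x_2,[x_3,x_4,x_5]]=[[x_1,x_2,x_3],x_4,x_5]+[x_3,[x_1,x_2,x_4],x_5]+[x_3,x_4,[x_1,x_2,x_5]]$ for all $x_i\in\mathfrak{g}$. A compatible 3-Lie algebra is a triple $(\mathfrak{g},[\cdot,\cdot,\cdot],\{\cdot,\cdot,\cdot\})$ where $[\cdot,\cdot,\cdot]$ and $\{\cdot,\cdot,\cdot\}$ are 3-Lie algebra structures on $\mathfrak{g}$ such that for all $x_1,\dots,x_5\in\mathfrak{g}$: $[x_1,x_2,\{x_3,x_4,x_5\}]+\{x_1,x_2,[x_3,x_4,x_5]\}=[\{x_1,x_2,x_3\},x_4,x_5]+\{[x_1,x_2,x_3],x_4,x_5\}+[x_3,\{x_1,x_2,x_4\},x_5]+\{x_3,[x_1,x_2,x_4],x_5\}+[x_3,x_4,\{x_1,x_2,x_5\}]+\{x_3,x_4,[x_1,x_2,x_5]\}$.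 Homomorphisms are linear maps preserving both 3-brackets. A representation of a 3-Lie algebra $(\mathfrak{g},[\cdot,\cdot,\cdot])$ on $V$ is a linear map $\rho:\wedge^2\mathfrak{g}\to\mathfrak{gl}(V)$ with $\rho(x_1,x_2)\rho(x_3,x_4)=\rho([x_1,x_2,x_3],x_4)+\rho(x_3,[x_1,x_2,x_4])+\rho(x_3,x_4)\rho(x_1,x_2)$ and $\rho(x_1,[x_2,x_3,x_4])=\rho(x_3,x_4)\rho(x_1,x_2)-\rho(x_2,x_4)\rho(x_1,x_3)+\rho(x_2,x_3)\rho(x_1,x_4)$. A representation $(V;\rho,\mu)$ of a compatible 3-Lie algebra $(\mathfrak{g},[\cdot,\cdot,\cdot],\{\cdot,\cdot,\cdot\})$ consists of a representation $\rho$ of $(\mathfrak{g},[\cdot,\cdot,\cdot])$ and a representation $\mu$ of $(\mathfrak{g},\{\cdot,\cdot,\cdot\})$ on $V$ with, for all $x_i$, $\rho(\{x_1,x_2,x_3\},x_4)+\mu([x_1,x_2,x_3],x_4)+\rho(x_3,\{x_1,x_2,x_4\})+\mu(x_3,[x_1,x_2,x_4])=[\rho(x_1,x_2),\mu(x_3,x_4)]-[\rho(x_3,x_4),\mu(x_1,x_2)]$ (commutators in $\mathfrak{gl}(V)$) and $\rho(\{x_1,x_2,x_3\},x_4)+\mu([x_1,x_2,x_3],x_4)-\rho(x_3,x_1)\mu(x_2,x_4)-\mu(x_3,x_1)\rho(x_2,x_4)=\rho(x_1,x_2)\mu(x_3,x_4)+\mu(x_1,x_2)\rho(x_3,x_4)+\rho(x_2,x_3)\mu(x_1,x_4)+\mu(x_2,x_3)\rho(x_1,x_4)$.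 Cohomology with coefficients in $(V;\rho,\mu)$ in low degrees: for a 3-Lie structure $\pi$ and representation $\rho$, $f\in\mathrm{Hom}(\mathfrak{g},V)$ and $\omega\in\mathrm{Hom}(\wedge^3\mathfrak{g},V)$: $\mathrm{d}^1_{\pi+\rho}f(x,y,z)=\rho(x,y)f(z)+\rho(y,z)f(x)+\rho(z,x)f(y)-f(\pi(x,y,z))$; $\mathrm{d}^2_{\pi+\rho}\omega(x_1,x_2,x_3,x_4,x_5)=\omega(x_1,x_2,\pi(x_3,x_4,x_5))-\omega(\pi(x_1,x_2,x_3),x_4,x_5)-\omega(x_3,\pi(x_1,x_2,x_4),x_5)-\omega(x_3,x_4,\pi(x_1,x_2,x_5))+\rho(x_1,x_2)\omega(x_3,x_4,x_5)-\rho(x_3,x_4)\omega(x_1,x_2,x_5)-\rho(x_4,x_5)\omega(x_1,x_2,x_3)-\rho(x_5,x_3)\omega(x_1,x_2,x_4)$. With $\pi_1=[\cdot,\cdot,\cdot]_{\mathfrak{g}}$, $\pi_2=\{\cdot,\cdot,\cdot\}_{\mathfrak{g}}$: $\delta^1f=(\mathrm{d}^1_{\pi_1+\rho}f,\mathrm{d}^1_{\pi_2+\mu}f)$ and, on 2-cochains $(\omega_1,\omega_2)\in\mathrm{Hom}(\wedge^3\mathfrak{g},V)^{\oplus2}$, $\delta^2(\omega_1,\omega_2)=(\mathrm{d}^2_{\pi_1+\rho}\omega_1,\ \mathrm{d}^2_{\pi_2+\mu}\omega_1+\mathrm{d}^2_{\pi_1+\rho}\omega_2,\ \mathrm{d}^2_{\pi_2+\mu}\omega_2)$.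 A 2-cocycle is an element of $\ker\delta^2$; two 2-cocycles are in the same cohomology class if they differ by an element of $\mathrm{im}\,\delta^1$. An extension of a compatible 3-Lie algebra $\mathfrak{g}$ by a compatible 3-Lie algebra $V$ is a short exact sequence of compatible 3-Lie algebras $0\to V\xrightarrow{i}\hat{\mathfrak{g}}\xrightarrow{p}\mathfrak{g}\to0$; it is abelian if $[u,v,\alpha]_{\hat{\mathfrak{g}}}=\{u,v,\alpha\}_{\hat{\mathfrak{g}}}=0$ for all $u,v\in V,\alpha\in\hat{\mathfrak{g}}$ (identifying $V$ with $i(V)$). Two abelian extensions $(\hat{\mathfrak{g}}_1,i_1,p_1)$ and $(\hat{\mathfrak{g}}_2,i_2,p_2)$ of $\mathfrak{g}$ by $V$ are isomorphic if there is a compatible 3-Lie algebra isomorphism $\theta:\hat{\mathfrak{g}}_1\to\hat{\mathfrak{g}}_2$ with $\theta\circ i_1=i_2$ and $p_2\circ\theta=p_1$. $\mathfrak{g}\oplus_{\rho,\mu,\omega_1,\omega_2}V$ denotes the abelian extension whose underlying space is $\mathfrak{g}\oplus V$, with the canonical inclusion of $V$ and projection onto $\mathfrak{g}$, and brackets, for $x,y,z\in\mathfrak{g}$, $u,v,w\in V$, $[x+u,y+v,z+w]_{\rho,\omega_1}=[x,y,z]_{\mathfrak{g}}+\rho(x,y)w+\rho(y,z)u+\rho(z,x)v+\omega_1(x,y,z)$, $\{x+u,y+v,z+w\}_{\mu,\omega_2}=\{x,y,z\}_{\mathfrak{g}}+\mu(x,y)w+\mu(y,z)u+\mu(z,x)v+\omega_2(x,y,z)$,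 where $\omega_1,\omega_2\in\mathrm{Hom}(\wedge^3\mathfrak{g},V)$ and $(\omega_1,\omega_2)$ is a 2-cocycle. *)

(* Defs.v *)
From HB Require Import structures.
From mathcomp Require Import all_boot all_order all_algebra.
From mathcomp Require Import ring.

Set Implicit Arguments.
Unset Strict Implicit.
Unset Printing Implicit Defensive.

Import GRing.Theory.
Local Open Scope ring_scope.

(* Skew-symmetry is the sign rule under transpositions of adjacent arguments.
   In characteristic different from 2 this says that the map vanishes on
   repeated arguments, so that [alt2 U W] and [alt3 U W] are Hom(/\^2 U, W)
   and Hom(/\^3 U, W). *)

Record alt2 (K : fieldType) (U W : vectType K) := Alt2 {
  alt2_fun :> U -> U -> W;
  alt2_lin1 : forall y, linear (fun x => alt2_fun x y);
  alt2_lin2 : forall x, linear (fun y => alt2_fun x y);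
  alt2_skew : forall x y, alt2_fun y x = - alt2_fun x y }.

Record alt3 (K : fieldType) (U W : vectType K) := Alt3 {
  alt3_fun :> U -> U -> U -> W;
  alt3_lin1 : forall y z, linear (fun x => alt3_fun x y z);
  alt3_lin2 : forall x z, linear (fun y => alt3_fun x y z);
  alt3_lin3 : forall x y, linear (fun z => alt3_fun x y z);
  alt3_skew12 : forall x y z, alt3_fun y x z = - alt3_fun x y z;
  alt3_skew23 : forall x y z, alt3_fun x z y = - alt3_fun x y z }.

Definition is_3Lie (K : fieldType) (g : vectType K) (pi : alt3 g g) : Prop :=
  forall x1 x2 x3 x4 x5 : g,
    pi x1 x2 (pi x3 x4 x5)
    = pi (pi x1 x2 x3) x4 x5 + pi x3 (pi x1 x2 x4) x5
      + pi x3 x4 (pi x1 x2 x5).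

Definition compatible_brackets (K : fieldType) (g : vectType K)
    (pi1 pi2 : alt3 g g) : Prop :=
  forall x1 x2 x3 x4 x5 : g,
    pi1 x1 x2 (pi2 x3 x4 x5) + pi2 x1 x2 (pi1 x3 x4 x5)
    = pi1 (pi2 x1 x2 x3) x4 x5 + pi2 (pi1 x1 x2 x3) x4 x5
      + pi1 x3 (pi2 x1 x2 x4) x5 + pi2 x3 (pi1 x1 x2 x4) x5
      + pi1 x3 x4 (pi2 x1 x2 x5) + pi2 x3 x4 (pi1 x1 x2 x5).

Record compat3Lie (K : fieldType) := Compat3Lie {
  c3sort :> vectType K;
  br1 : alt3 c3sort c3sort;
  br2 : alt3 c3sort c3sort;
  br1_3Lie : is_3Lie br1;
  br2_3Lie : is_3Lie br2;
  br12_compat : compatible_brackets br1 br2 }.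

Arguments br1 {K c}.
Arguments br2 {K c}.

Definition compat3Lie_hom (K : fieldType) (g h : compat3Lie K)
    (f : 'Hom(g, h)) : Prop :=
  (forall x y z : g, f (br1 x y z) = br1 (f x) (f y) (f z))
  /\ (forall x y z : g, f (br2 x y z) = br2 (f x) (f y) (f z)).

Section Representations.
Variables (K : fieldType) (g V : vectType K).

Record is_rep (pi : alt3 g g) (rho : alt2 g 'End(V)) : Prop := IsRep {
  rep_comm : forall x1 x2 x3 x4 : g,
    (rho x1 x2 \o rho x3 x4)%VF
    = rho (pi x1 x2 x3) x4 + rho x3 (pi x1 x2 x4)
      + (rho x3 x4 \o rho x1 x2)%VF;
  rep_br : forall x1 x2 x3 x4 : g,
    rho x1 (pi x2 x3 x4)
    = (rho x3 x4 \o rho x1 x2)%VF - (rho x2 x4 \o rho x1 x3)%VF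
      + (rho x2 x3 \o rho x1 x4)%VF }.

Definition lfun_comm (a b : 'End(V)) : 'End(V) := (a \o b)%VF - (b \o a)%VF.

Record compatible_reps (pi1 pi2 : alt3 g g) (rho mu : alt2 g 'End(V)) : Prop :=
  CompatibleReps {
  creps_comm : forall x1 x2 x3 x4 : g,
    rho (pi2 x1 x2 x3) x4 + mu (pi1 x1 x2 x3) x4
      + rho x3 (pi2 x1 x2 x4) + mu x3 (pi1 x1 x2 x4)
    = lfun_comm (rho x1 x2) (mu x3 x4) - lfun_comm (rho x3 x4) (mu x1 x2);
  creps_br : forall x1 x2 x3 x4 : g,
    rho (pi2 x1 x2 x3) x4 + mu (pi1 x1 x2 x3) x4
      - (rho x3 x1 \o mu x2 x4)%VF - (mu x3 x1 \o rho x2 x4)%VF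
    = (rho x1 x2 \o mu x3 x4)%VF + (mu x1 x2 \o rho x3 x4)%VF
      + (rho x2 x3 \o mu x1 x4)%VF + (mu x2 x3 \o rho x1 x4)%VF }.

Definition d1 (pi : alt3 g g) (rho : alt2 g 'End(V)) (f : 'Hom(g, V))
    (x y z : g) : V :=
  rho x y (f z) + rho y z (f x) + rho z x (f y) - f (pi x y z).

Definition d2 (pi : alt3 g g) (rho : alt2 g 'End(V)) (w : alt3 g V)
    (x1 x2 x3 x4 x5 : g) : V :=
  w x1 x2 (pi x3 x4 x5) - w (pi x1 x2 x3) x4 x5
  - w x3 (pi x1 x2 x4) x5 - w x3 x4 (pi x1 x2 x5)
  + rho x1 x2 (w x3 x4 x5) - rho x3 x4 (w x1 x2 x5)
  - rho x4 x5 (w x1 x2 x3) - rho x5 x3 (w x1 x2 x4).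

End Representations.

Record compat_rep (K : fieldType) (g : compat3Lie K) (V : vectType K) :=
  CompatRep {
  rep1 : alt2 g 'End(V);
  rep2 : alt2 g 'End(V);
  rep1P : is_rep br1 rep1;
  rep2P : is_rep br2 rep2;
  rep12P : compatible_reps br1 br2 rep1 rep2 }.

Section Cohomology.
Variables (K : fieldType) (g : compat3Lie K) (V : vectType K).
Variable r : compat_rep g V.

Definition cochain2 : Type := alt3 g V * alt3 g V.

Definition delta1 (f : 'Hom(g, V)) : (g -> g -> g -> V) * (g -> g -> g -> V) :=
  (d1 br1 (rep1 r) f, d1 br2 (rep2 r) f).

Definition delta2 (w : cochain2) :
    (g -> g -> g -> g -> g -> V) * (g -> g -> g -> g -> g -> V)
    * (g -> g -> g -> g -> g -> V) :=
  (d2 br1 (rep1 r) w.1,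
   fun x1 x2 x3 x4 x5 => d2 br2 (rep2 r) w.1 x1 x2 x3 x4 x5
                         + d2 br1 (rep1 r) w.2 x1 x2 x3 x4 x5,
   d2 br2 (rep2 r) w.2).

Definition is_cocycle2 (w : cochain2) : Prop :=
  forall x1 x2 x3 x4 x5 : g,
    [/\ (delta2 w).1.1 x1 x2 x3 x4 x5 = 0,
        (delta2 w).1.2 x1 x2 x3 x4 x5 = 0
      & (delta2 w).2 x1 x2 x3 x4 x5 = 0].

Definition same_class (w w' : cochain2) : Prop :=
  exists f : 'Hom(g, V), forall x y z : g,
    w.1 x y z - w'.1 x y z = (delta1 f).1 x y z
    /\ w.2 x y z - w'.2 x y z = (delta1 f).2 x y z.

End Cohomology.

Record extension (K : fieldType) (g V : compat3Lie K) := Extension {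
  ext_mid : compat3Lie K;
  ext_i : 'Hom(V, ext_mid);
  ext_p : 'Hom(ext_mid, g);
  ext_i_hom : compat3Lie_hom ext_i;
  ext_p_hom : compat3Lie_hom ext_p;
  ext_i_inj : lker ext_i = 0%VS;
  ext_exact : limg ext_i = lker ext_p;
  ext_p_surj : limg ext_p = fullv }.

Definition is_abelian_extension (K : fieldType) (g V : compat3Lie K)
    (E : extension g V) : Prop :=
  forall (u v : V) (a : ext_mid E),
    br1 (ext_i E u) (ext_i E v) a = 0 /\ br2 (ext_i E u) (ext_i E v) a = 0.

Record abelian_extension (K : fieldType) (g V : compat3Lie K) :=
  AbelianExtension {
  abext_ext :> extension g V;
  abextP : is_abelian_extension abext_ext }.

Definition isomorphic_extensions (K : fieldType) (g V : compat3Lie K)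
    (E1 E2 : abelian_extension g V) : Prop :=
  exists theta : 'Hom(ext_mid E1, ext_mid E2),
    [/\ compat3Lie_hom theta, bijective theta,
        (theta \o ext_i E1)%VF = ext_i E2
      & (ext_p E2 \o theta)%VF = ext_p E1].

(* In an abelian extension both brackets of the kernel vanish. A vector space V
   is therefore made into a compatible 3-Lie algebra by zero brackets. *)
Section TrivialAlgebra.
Variables (K : fieldType) (V : vectType K).

Fact zero_linear (W : vectType K) : linear (fun _ : V => 0 : W).
Proof. by move=> a x y; rewrite scaler0 addr0. Qed.

Definition alt3_zero (W : vectType K) : alt3 V W :=
  @Alt3 K V W (fun _ _ _ => 0)
    (fun _ _ => zero_linear W) (fun _ _ => zero_linear W)
    (fun _ _ => zero_linear W)
    (fun _ _ _ => esym (@oppr0 W)) (fun _ _ _ => esym (@oppr0 W)).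

Fact alt3_zero_3Lie : is_3Lie (alt3_zero V).
Proof. by move=> *; rewrite /= !addr0. Qed.

Fact alt3_zero_compat : compatible_brackets (alt3_zero V) (alt3_zero V).
Proof. by move=> *; rewrite /= !addr0. Qed.

Definition trivial_c3Lie : compat3Lie K :=
  Compat3Lie alt3_zero_3Lie alt3_zero_3Lie alt3_zero_compat.

End TrivialAlgebra.

Lemma eq_coord (K : fieldType) (V : vectType K) (a b : V) :
  (forall phi : V -> K, {morph phi : x y / x + y} -> {morph phi : x / - x} ->
     (forall k x, phi (k *: x) = k * phi x) -> phi 0 = 0 -> phi a = phi b) ->
  a = b.
Proof.
move=> h; rewrite (coord_vbasis (memvf a)) (coord_vbasis (memvf b)).
apply: eq_bigr => j _; congr (_ *: _).
by apply: h => [x y | x | k x |]; rewrite (linearD, linearN, linearZ, linear0).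
Qed.

Lemma linear_DZ (K : fieldType) (U W : vectType K) (f : U -> W) : linear f ->
  (forall x y, f (x + y) = f x + f y) /\ (forall k x, f (k *: x) = k *: f x).
Proof.
move=> fL; have fD x y : f (x + y) = f x + f y.
  by have := fL 1 x y; rewrite !scale1r.
split=> // k x; have f0 : f 0 = 0 by apply: (addrI (f 0)); rewrite -fD !addr0.
by rewrite -[k *: x]addr0 fL f0 addr0.
Qed.

Ltac coords :=
  let phi := fresh "phi" in let pD := fresh in let pN := fresh in
  let pZ := fresh in let p0 := fresh in
  apply: eq_coord => phi pD pN pZ p0; rewrite !(pD, pN, pZ, p0); ring.

Section SemidirectBracket.
Variables (K : fieldType) (g V : vectType K).
Implicit Types (pi : alt3 g g) (rho : alt2 g 'End(V)) (w : alt3 g V).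

Definition sd_fun pi rho w (X Y Z : (g * V)%type) : (g * V)%type :=
  (pi X.1 Y.1 Z.1,
   rho X.1 Y.1 Z.2 + rho Y.1 Z.1 X.2 + rho Z.1 X.1 Y.2 + w X.1 Y.1 Z.1).

Lemma alt2D1 rho x y z u : rho (x + y) z u = rho x z u + rho y z u.
Proof. by have [-> _] := linear_DZ (alt2_lin1 rho z); rewrite lfunE. Qed.
Lemma alt2D2 rho x y z u : rho z (x + y) u = rho z x u + rho z y u.
Proof. by have [-> _] := linear_DZ (alt2_lin2 rho z); rewrite lfunE. Qed.
Lemma alt2Z1 rho k x z u : rho (k *: x) z u = k *: rho x z u.
Proof. by have [_ ->] := linear_DZ (alt2_lin1 rho z); rewrite lfunE. Qed.
Lemma alt2Z2 rho k x z u : rho z (k *: x) u = k *: rho z x u.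
Proof. by have [_ ->] := linear_DZ (alt2_lin2 rho z); rewrite lfunE. Qed.
Lemma alt2N rho x y u : rho y x u = - rho x y u.
Proof. by rewrite alt2_skew lfunE. Qed.

Fact sd_lin1 pi rho w Y Z : linear (fun X => sd_fun pi rho w X Y Z).
Proof.
move=> k X X'; rewrite /sd_fun; congr pair; rewrite /= ?alt3_lin1 //.
rewrite !(alt2D1, alt2D2, alt2Z1, alt2Z2, linearD, linearZ) /=.
by coords.
Qed.

Fact sd_lin2 pi rho w X Z : linear (fun Y => sd_fun pi rho w X Y Z).
Proof.
move=> k Y Y'; rewrite /sd_fun; congr pair; rewrite /= ?alt3_lin2 //.
rewrite !(alt2D1, alt2D2, alt2Z1, alt2Z2, linearD, linearZ) /=.
by coords.
Qed.

Fact sd_lin3 pi rho w X Y : linear (fun Z => sd_fun pi rho w X Y Z).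
Proof.
move=> k Z Z'; rewrite /sd_fun; congr pair; rewrite /= ?alt3_lin3 //.
rewrite !(alt2D1, alt2D2, alt2Z1, alt2Z2, linearD, linearZ) /=.
by coords.
Qed.

Fact sd_skew12 pi rho w X Y Z : sd_fun pi rho w Y X Z = - sd_fun pi rho w X Y Z.
Proof.
rewrite /sd_fun; congr pair => /=; first by rewrite alt3_skew12.
rewrite (alt3_skew12 w).
rewrite [rho Y.1 X.1 _]alt2N [rho X.1 Z.1 _]alt2N [rho Z.1 Y.1 _]alt2N.
by coords.
Qed.

Fact sd_skew23 pi rho w X Y Z : sd_fun pi rho w X Z Y = - sd_fun pi rho w X Y Z.
Proof.
rewrite /sd_fun; congr pair => /=; first by rewrite alt3_skew23.
rewrite (alt3_skew23 w).
rewrite [rho Y.1 X.1 _]alt2N [rho X.1 Z.1 _]alt2N [rho Z.1 Y.1 _]alt2N.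
by coords.
Qed.

Definition sd_bracket pi rho w : alt3 (g * V)%type (g * V)%type :=
  Alt3 (sd_lin1 pi rho w) (sd_lin2 pi rho w) (sd_lin3 pi rho w)
       (sd_skew12 pi rho w) (sd_skew23 pi rho w).

(* The next four terms measure the failure of the fundamental identity, of the
   two axioms of a representation and of the cocycle condition. They mix two
   structures, so that (pi, pi) gives the axioms of one structure and
   (pi, pi') + (pi', pi) the compatibility conditions. *)
Definition fund_defect (U : vectType K) (B B' : alt3 U U) x1 x2 x3 x4 x5 :=
  B x1 x2 (B' x3 x4 x5) - B (B' x1 x2 x3) x4 x5 - B x3 (B' x1 x2 x4) x5
  - B x3 x4 (B' x1 x2 x5).

Definition rep_defect1 rho pi' rho' x1 x2 a b u :=
  rho x1 x2 (rho' a b u) - rho (pi' x1 x2 a) b u - rho a (pi' x1 x2 b) u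
  - rho a b (rho' x1 x2 u).

Definition rep_defect2 rho pi' rho' a b c d u :=
  rho a (pi' b c d) u - rho c d (rho' a b u) + rho b d (rho' a c u)
  - rho b c (rho' a d u).

Definition d2_defect rho w pi' w' x1 x2 x3 x4 x5 :=
  w x1 x2 (pi' x3 x4 x5) - w (pi' x1 x2 x3) x4 x5 - w x3 (pi' x1 x2 x4) x5
  - w x3 x4 (pi' x1 x2 x5) + rho x1 x2 (w' x3 x4 x5)
  - rho x3 x4 (w' x1 x2 x5) - rho x4 x5 (w' x1 x2 x3)
  - rho x5 x3 (w' x1 x2 x4).

Lemma sd_fund_defect pi rho w pi' rho' w' X1 X2 X3 X4 X5 :
  fund_defect (sd_bracket pi rho w) (sd_bracket pi' rho' w') X1 X2 X3 X4 X5
  = (fund_defect pi pi' X1.1 X2.1 X3.1 X4.1 X5.1,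
     rep_defect1 rho pi' rho' X1.1 X2.1 X3.1 X4.1 X5.2
     + rep_defect1 rho pi' rho' X1.1 X2.1 X5.1 X3.1 X4.2
     + rep_defect1 rho pi' rho' X1.1 X2.1 X4.1 X5.1 X3.2
     + rep_defect2 rho pi' rho' X2.1 X3.1 X4.1 X5.1 X1.2
     - rep_defect2 rho pi' rho' X1.1 X3.1 X4.1 X5.1 X2.2
     + d2_defect rho w pi' w' X1.1 X2.1 X3.1 X4.1 X5.1).
Proof.
case: X1 X2 X3 X4 X5 => [x1 u1] [x2 u2] [x3 u3] [x4 u4] [x5 u5].
rewrite /fund_defect /rep_defect1 /rep_defect2 /d2_defect /sd_bracket /= /sd_fun /=; congr pair => /=.
rewrite !linearD /= (alt2N rho x1 (pi' x3 x4 x5)).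
rewrite (alt2N rho' x1 x3) (alt2N rho' x1 x4) (alt2N rho' x1 x5) !linearN /=.
rewrite !(alt2N rho x3 x5).
by coords.
Qed.

Lemma fund_defect0 (U : vectType K) (B : alt3 U U) :
  is_3Lie B <-> forall x1 x2 x3 x4 x5, fund_defect B B x1 x2 x3 x4 x5 = 0.
Proof.
split=> h x1 x2 x3 x4 x5; first by rewrite /fund_defect h; coords.
apply/eqP; rewrite -subr_eq0 -(h x1 x2 x3 x4 x5) /fund_defect; apply/eqP.
by coords.
Qed.

Lemma fund_defectD0 (U : vectType K) (B B' : alt3 U U) :
  compatible_brackets B B' <-> forall x1 x2 x3 x4 x5,
    fund_defect B B' x1 x2 x3 x4 x5 + fund_defect B' B x1 x2 x3 x4 x5 = 0.
Proof.
split=> h x1 x2 x3 x4 x5; have := h x1 x2 x3 x4 x5; rewrite /fund_defect.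
  by move=> /eqP; rewrite -subr_eq0 => /eqP e; rewrite -[RHS]e; coords.
move=> e; apply/eqP; rewrite -subr_eq0 -e; apply/eqP; by coords.
Qed.

Lemma rep_defect1_0 pi rho x1 x2 a b u : is_rep pi rho ->
  rep_defect1 rho pi rho x1 x2 a b u = 0.
Proof.
case=> /(_ x1 x2 a b) /lfunP /(_ u) + _; rewrite !lfun_simp => e.
by rewrite /rep_defect1 e; coords.
Qed.

Lemma rep_defect2_0 pi rho a b c d u : is_rep pi rho ->
  rep_defect2 rho pi rho a b c d u = 0.
Proof.
case=> _ /(_ a b c d) /lfunP /(_ u); rewrite !lfun_simp => e.
by rewrite /rep_defect2 e; coords.
Qed.

Lemma rep_defect1D0 pi rho pi' rho' x1 x2 a b u :
  compatible_reps pi pi' rho rho' ->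
  rep_defect1 rho pi' rho' x1 x2 a b u
  + rep_defect1 rho' pi rho x1 x2 a b u = 0.
Proof.
case=> /(_ x1 x2 a b) /lfunP /(_ u) + _; rewrite /lfun_comm !lfun_simp.
move=> /eqP; rewrite eq_sym -subr_eq0 => /eqP e; rewrite -[RHS]e.
by rewrite /rep_defect1; coords.
Qed.

Lemma rep_defect2D0 pi rho pi' rho' a b c d u :
  compatible_reps pi pi' rho rho' ->
  rep_defect2 rho pi' rho' a b c d u + rep_defect2 rho' pi rho a b c d u = 0.
Proof.
case=> _ /(_ b c d a) /lfunP /(_ u); rewrite /lfun_comm !lfun_simp.
move=> /eqP; rewrite eq_sym -subr_eq0 => /eqP e; rewrite -[RHS]e.
rewrite /rep_defect2 (alt2N _ a (pi _ _ _)) (alt2N _ a (pi' _ _ _)).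
rewrite !(alt2N _ a b) !(alt2N _ a c) !(alt2N _ a d) !(alt2N _ b d).
by rewrite !(linearN (rho _ _)) !(linearN (rho' _ _)) /=; coords.
Qed.

Lemma sd_bracket_3Lie pi rho w : is_3Lie pi -> is_rep pi rho ->
  (forall x1 x2 x3 x4 x5, d2 pi rho w x1 x2 x3 x4 x5 = 0) ->
  is_3Lie (sd_bracket pi rho w).
Proof.
move=> /fund_defect0 pi0 r0 w0; apply/fund_defect0 => X1 X2 X3 X4 X5.
rewrite sd_fund_defect pi0 !rep_defect1_0 // !rep_defect2_0 //.
by rewrite [d2_defect _ _ _ _ _ _ _ _ _]w0 !addr0 subr0.
Qed.

Lemma sd_bracket_compat pi rho w pi' rho' w' :
  compatible_brackets pi pi' -> compatible_reps pi pi' rho rho' ->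
  (forall x1 x2 x3 x4 x5,
     d2 pi' rho' w x1 x2 x3 x4 x5 + d2 pi rho w' x1 x2 x3 x4 x5 = 0) ->
  compatible_brackets (sd_bracket pi rho w) (sd_bracket pi' rho' w').
Proof.
move=> /fund_defectD0 pi0 r0 w0; apply/fund_defectD0 => X1 X2 X3 X4 X5.
rewrite !sd_fund_defect; congr pair => /=; first exact: pi0.
pose t a b u := rep_defect1D0 X1.1 X2.1 a b u r0.
pose s a u := rep_defect2D0 a X3.1 X4.1 X5.1 u r0.
have e := w0 X1.1 X2.1 X3.1 X4.1 X5.1.
transitivity (0 + 0 + 0 + 0 - 0 + 0 : V); last by rewrite !addr0 subr0.
rewrite -{1}(t X3.1 X4.1 X5.2) -{1}(t X5.1 X3.1 X4.2) -{1}(t X4.1 X5.1 X3.2).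
rewrite -{1}(s X2.1 X1.2) -{1}(s X1.1 X2.2) -e /d2 /d2_defect.
by coords.
Qed.

End SemidirectBracket.

Section SemidirectExtension.
Variables (K : fieldType) (g : compat3Lie K) (V : vectType K).
Variables (r : compat_rep g V) (w : cochain2 g V).

Definition sd_inj (u : V) : (g * V)%type := (0, u).

Fact sd_inj_linear : linear sd_inj.
Proof. by move=> k u v; congr pair; rewrite /= scaler0 addr0. Qed.

HB.instance Definition _ :=
  GRing.isLinear.Build K V (g * V)%type *:%R sd_inj sd_inj_linear.

Hypothesis w_cocycle : is_cocycle2 r w.

Fact sd_br1_3Lie : is_3Lie (sd_bracket br1 (rep1 r) w.1).
Proof.
apply: (sd_bracket_3Lie (@br1_3Lie _ g) (rep1P r)) => x1 x2 x3 x4 x5.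
by case: (w_cocycle x1 x2 x3 x4 x5).
Qed.

Fact sd_br2_3Lie : is_3Lie (sd_bracket br2 (rep2 r) w.2).
Proof.
apply: (sd_bracket_3Lie (@br2_3Lie _ g) (rep2P r)) => x1 x2 x3 x4 x5.
by case: (w_cocycle x1 x2 x3 x4 x5).
Qed.

Fact sd_br12_compat :
  compatible_brackets (sd_bracket br1 (rep1 r) w.1)
                      (sd_bracket br2 (rep2 r) w.2).
Proof.
apply: (sd_bracket_compat (@br12_compat _ g) (rep12P r)) => x1 x2 x3 x4 x5.
by case: (w_cocycle x1 x2 x3 x4 x5).
Qed.

Definition sd_c3Lie : compat3Lie K :=
  Compat3Lie sd_br1_3Lie sd_br2_3Lie sd_br12_compat.

Definition sd_i : 'Hom(trivial_c3Lie V, sd_c3Lie) := linfun sd_inj.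
Definition sd_p : 'Hom(sd_c3Lie, g) := linfun (@fst g V).

Lemma sd_iE u : sd_i u = (0, u).
Proof. by rewrite lfunE. Qed.

Lemma sd_pE X : sd_p X = X.1.
Proof. by rewrite lfunE. Qed.

Lemma sd_fun_inj pi rho (w0 : alt3 g V) u v (X : (g * V)%type) :
  sd_fun pi rho w0 (0, u) (0, v) X = 0.
Proof.
have a3 (W : vectType K) (f : alt3 g W) y z : f 0 y z = 0.
  by have := (linear_DZ (alt3_lin1 f y z)).2 0 0; rewrite !scale0r.
have a21 z t : rho 0 z t = 0 by rewrite -(scale0r 0) alt2Z1 scale0r.
have a22 z t : rho z 0 t = 0 by rewrite -(scale0r 0) alt2Z2 scale0r.
by rewrite /sd_fun /= !a3 !a21 a22 !addr0.
Qed.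

Fact sd_i_hom : compat3Lie_hom sd_i.
Proof. by split=> x y z; rewrite !sd_iE [RHS]sd_fun_inj. Qed.

Fact sd_p_hom : compat3Lie_hom sd_p.
Proof. by split=> x y z; rewrite !sd_pE. Qed.

Fact sd_i_inj : lker sd_i = 0%VS.
Proof. by apply/eqP/lker0P => u v; rewrite !sd_iE => -[]. Qed.

Fact sd_exact : limg sd_i = lker sd_p.
Proof.
apply/vspaceP => X; rewrite memv_ker sd_pE; apply/idP/eqP.
  by move=> /memv_imgP[u _ ->]; rewrite sd_iE.
by case: X => x u /= ->; apply/memv_imgP; exists u; rewrite ?memvf ?sd_iE.
Qed.

Fact sd_p_surj : limg sd_p = fullv.
Proof.
apply/vspaceP => x; rewrite memvf; apply/memv_imgP.
by exists (x, 0); rewrite ?memvf ?sd_pE.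
Qed.

Definition sd_ext : extension g (trivial_c3Lie V) :=
  Extension sd_i_hom sd_p_hom sd_i_inj sd_exact sd_p_surj.

Fact sd_ext_abelian : is_abelian_extension sd_ext.
Proof. by move=> u v X; rewrite /= !sd_iE; split; apply: sd_fun_inj. Qed.

Definition sd_extension : abelian_extension g (trivial_c3Lie V) :=
  AbelianExtension sd_ext_abelian.

End SemidirectExtension.

(* Main.v *)
From HB Require Import structures.
Require Import Defs.
From mathcomp Require Import all_boot all_order all_algebra.
From mathcomp Require Import ring.

Set Implicit Arguments.
Unset Strict Implicit.
Unset Printing Implicit Defensive.

Import GRing.Theory.
Local Open Scope ring_scope.

(** An isomorphism of extensions of [g] by [V] whose underlying spaces are both
    [g * V] induces the identity on the subspace [V] and on the quotient [g],
    so it is a unipotent shear [(x, u) |-> (x, u + f x)] for a unique linear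
    map [f : g -> V] (lemma [ext_morphism_shear]). Conversely every shear is
    bijective, with inverse the shear by [- f], and is the identity on [V]
    and on [g].

    What remains is to see when a shear is a homomorphism. Expanding
    [[x + u + f x, y + v + f y, z + t + f z]], the terms in [u], [v], [t] agree
    on both sides, since the action of [g] on [V] is the same for the two
    brackets, and the terms that are left say exactly that the cochains
    [w] and [w'] differ by the coboundary [d1 f] (lemma [shear_morphP]). The
    same [f] serves the two brackets of a compatible 3-Lie algebra, which is
    the definition of cohomologous 2-cocycles. *)

Section Shear.
Variables (K : fieldType) (g V : vectType K).

Definition shear (f : 'Hom(g, V)) (X : (g * V)%type) : (g * V)%type :=
  (X.1, X.2 + f X.1).

Fact shear_linear f : linear (shear f).
Proof.
move=> k X Y; congr pair; rewrite /= linearP scalerDr -!addrA.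
by congr (_ + _); rewrite addrCA.
Qed.

HB.instance Definition _ f :=
  GRing.isLinear.Build K (g * V)%type (g * V)%type *:%R (shear f)
    (shear_linear f).

Lemma shear_bij f : bijective (shear f).
Proof.
by exists (shear (- f)) => -[x u]; rewrite /shear /= opp_lfunE ?addrK ?subrK.
Qed.

(** The coboundary measures how far a shear is from respecting the bracket of
    a semidirect product. The terms in the [V]-components cancel, so
    evaluation on [g * 0] already gives the whole condition. *)
Lemma shear_morphP (pi : alt3 g g) (rho : alt2 g 'End(V)) (w w' : alt3 g V)
    (f : 'Hom(g, V)) :
  (forall X Y Z, shear f (sd_bracket pi rho w X Y Z)
     = sd_bracket pi rho w' (shear f X) (shear f Y) (shear f Z))
  <-> (forall x y z, w x y z - w' x y z = d1 pi rho f x y z).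
Proof.
split=> [h x y z | h X Y Z].
  have /(congr1 snd) := h (x, 0) (y, 0) (z, 0).
  rewrite /= !linear0 !add0r => /eqP; rewrite -subr_eq0 => /eqP e.
  by apply/eqP; rewrite -subr_eq0 -e /d1; apply/eqP; coords.
congr pair => /=; move/eqP: (h X.1 Y.1 Z.1); rewrite -subr_eq0 => /eqP e.
by apply/eqP; rewrite -subr_eq0 -e /d1 !linearD /=; apply/eqP; coords.
Qed.

(** The [V]-component of [theta (x, 0)] is the shearing map: linearity splits
    [(x, u)] into [(x, 0)], whose [g]-component is preserved, and [(0, u)],
    which is fixed. *)
Lemma ext_morphism_shear (theta : {linear (g * V)%type -> (g * V)%type}) :
  (forall u, theta (0, u) = (0, u)) -> (forall X, (theta X).1 = X.1) ->
  exists f : 'Hom(g, V), theta =1 shear f.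
Proof.
move=> thV thg.
have fL : linear (fun x : g => (theta (x, 0)).2).
  move=> k x y; have -> : (k *: x + y, 0) = k *: (x, 0) + (y, 0) :> (g * V)%type.
    by congr pair; rewrite /= scaler0 addr0.
  by rewrite linearP.
pose F : {linear g -> V} :=
  HB.pack (fun x : g => (theta (x, 0)).2) (GRing.isLinear.Build K g V *:%R _ fL).
exists (linfun F) => -[x u]; rewrite /shear lfunE /=.
have -> : (x, u) = (0, u) + (x, 0) by congr pair; rewrite /= ?add0r ?addr0.
by rewrite linearD thV; congr pair; rewrite /= thg /= add0r.
Qed.

End Shear.

Theorem theorem4p14 (K : closedFieldType) (charK : [pchar K] =i pred0)
    (g : compat3Lie K) (V : vectType K) (r : compat_rep g V)
    (w1 w2 w1' w2' : alt3 g V)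
    (hw : is_cocycle2 r (w1, w2)) (hw' : is_cocycle2 r (w1', w2')) :
  isomorphic_extensions (sd_extension hw) (sd_extension hw')
  <-> same_class r (w1, w2) (w1', w2').
Proof.
split=> [[theta [[th1 th2] _ /lfunP thi /lfunP thp]] | [f fP]].
  have thV u : theta (0, u) = (0, u).
    by have := thi u; rewrite comp_lfunE /= !sd_iE.
  have thg X : (theta X).1 = X.1.
    by have := thp X; rewrite comp_lfunE /= !sd_pE.
  have [f thf] := ext_morphism_shear thV thg.
  exists f => x y z; split; move: x y z; apply/shear_morphP => X Y Z.
    by rewrite -!thf; apply: th1.
  by rewrite -!thf; apply: th2.
pose theta : 'Hom(sd_c3Lie hw, sd_c3Lie hw') := linfun (shear f).
have thE X : theta X = shear f X by rewrite lfunE.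
exists theta; split.
- split=> X Y Z; rewrite !thE; move: X Y Z; apply/shear_morphP => x y z.
    by have [] := fP x y z.
  by have [] := fP x y z.
- exact: eq_bij (shear_bij f) _ (fun X => esym (thE X)).
- apply/lfunP => u; rewrite comp_lfunE thE !sd_iE /shear /=.
  by rewrite linear0 addr0.
- by apply/lfunP => X; rewrite comp_lfunE thE !sd_pE.
Qed.
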